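(* Let $E$ be a separable metrizable space with Borel $\sigma$-algebra $\mathcal{B}$, let $C_b^+$ be the set of bounded continuous maps from $E$ to $\mathbb{R}_+$, and let $V : C_b^+ \rightarrow \mathbb{R}_+$ be a linear form on $C_b^+$ that preserves countable pointwise suprema. Then there exists a unique (finite) regular maxitive measure $\nu$ on $\mathcal{B}$ such that $$V(f) = \int^{\infty} f\,d\nu\quad\text{for all } f \in C_b^+.$$ Moreover, if $E$ is Polish, then the following conditions are equivalent: (i) $V$ is optimal; (ii) $V$ is tight; (iii) $\nu$ is tight; (iv) $c^{+}$ is upper-compact, where $c^{+}$ is the maximal cardinal density of $\nu$.
   Context: Here $\oplus$ denotes (pointwise) maximum/supremum. A linear form on $C_b^+$ is a map $V:C_b^+\to\mathbb{R}_+$ with $V(f\oplus g)=V(f)\oplus V(g)$ and $V(t f)=t\,V(f)$ for all $f,g\in C_b^+$, $t\in\mathbb{R}_+$. $V$ preserves countable pointwise suprema if, whenever $(f_n)$ is a countable family in $C_b^+$ whose pointwise supremum $f$ belongs to $C_b^+$, $V(f)=\sup_n V(f_n)$. $V$ is optimal if $V(f_n)\to0$ for every nonincreasing sequence $(f_n)$ in $C_b^+$ tending pointwise to $0$. $V$ is tight if for all $\varepsilon>0$ there is a compact $K\subset E$ such that $V(f)\leqslant\varepsilon\|f\|$ for each $f\in C_b^+$ equal to $0$ on $K$ ($\|\cdot\|$ the sup norm). A maxitive measure on $\mathcal{B}$ is a map $\nu:\mathcal{B}\to[0,\infty]$ with $\nu(\emptyset)=0$ and $\nu(B_1\cup B_2)=\nu(B_1)\oplus\nu(B_2)$.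 It is finite if it takes only finite values. It is regular if for all $B\in\mathcal{B}$, $\nu(B)=\sup\{\nu(K):K\subset B,\ K\text{ compact}\}=\inf\{\nu(G):G\supset B,\ G\text{ open}\}$. It is tight if for all $\varepsilon>0$ there is a compact $K\subset E$ with $\nu(E\setminus K)\leqslant\varepsilon$. The Shilkret integral of a Borel measurable $f:E\to[0,\infty]$ is $\int^{\infty}f\,d\nu=\sup_{t\in\mathbb{R}_+}t\,\nu(\{f>t\})$. The maximal cardinal density of $\nu$ is $c^+(x)=\inf\{\nu(G):G\ni x,\ G\text{ open}\}$ (a regular maxitive measure satisfies $\nu(B)=\sup_{x\in B}c^+(x)$ for all $B\in\mathcal{B}$). A map $c^+:E\to[0,\infty]$ is upper-compact if $\{c^+\geqslant t\}$ is compact for all $t>0$. *)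

(* Defs.v *)
From mathcomp Require Import all_boot all_order all_algebra.
From mathcomp Require Import all_classical all_reals all_analysis.

Set Implicit Arguments.
Unset Strict Implicit.
Unset Printing Implicit Defensive.

Import Order.TTheory GRing.Theory Num.Theory.
Import numFieldNormedType.Exports.

Local Open Scope classical_set_scope.
Local Open Scope ring_scope.

Section Spaces.
Context {R : realType} {E : topologicalType}.

Definition is_metric (d : E -> E -> R) : Prop :=
  [/\ forall x y, 0 <= d x y,
      forall x y, d x y = 0 <-> x = y,
      forall x y, d x y = d y x &
      forall x y z, d x z <= d x y + d y z].

Definition compatible_metric (d : E -> E -> R) : Prop :=
  is_metric d /\
  forall x : E,
    nbhs x = filter_from [set e : R | 0 < e] (fun e => [set y | d x y < e]).

(* Convergence is taken in the topology of [E]; this is convergence for [d] as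
   soon as [d] is compatible. *)
Definition complete_metric (d : E -> E -> R) : Prop :=
  forall u : nat -> E,
    (forall e : R, 0 < e ->
       exists N : nat, forall m n : nat,
         (N <= m)%N -> (N <= n)%N -> d (u m) (u n) < e) ->
    exists l : E, u @ \oo --> l.

End Spaces.

(* The real field in which metrics take their values is an explicit argument. *)
Definition metrizable (R : realType) (E : topologicalType) : Prop :=
  exists d : E -> E -> R, compatible_metric d.

Definition separable (E : topologicalType) : Prop :=
  exists2 S : set E, countable S & dense S.

Definition polish (R : realType) (E : topologicalType) : Prop :=
  separable E /\
  exists d : E -> E -> R, compatible_metric d /\ complete_metric d.

Definition borel (E : topologicalType) : set (set E) :=
  <<s [set A : set E | open A] >>.

(* A map [C_b^+ -> R_+] is encoded as a map [V : (E -> R) -> R] of which only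
   the values on [Cb_plus] are ever considered. *)
Section Forms.
Context {R : realType} {E : topologicalType}.
Implicit Types (f g : E -> R) (V : (E -> R) -> R).

Definition Cb_plus : set (E -> R) :=
  [set f : E -> R | [/\ continuous f, bounded_fun f & forall x, 0 <= f x]].

Definition linear_form V : Prop :=
  [/\ forall f, Cb_plus f -> 0 <= V f,
      forall f g, Cb_plus f -> Cb_plus g ->
        V (fun x => Num.max (f x) (g x)) = Num.max (V f) (V g) &
      forall (t : R) f, 0 <= t -> Cb_plus f -> V (fun x => t * f x) = t * V f].

(* Suprema are taken in the extended reals, where they always exist. *)
Definition preserves_countable_sup V : Prop :=
  forall (fs : nat -> E -> R) f,
    (forall n, Cb_plus (fs n)) -> Cb_plus f ->
    (forall x, (f x)%:E = ereal_sup (range (fun n => (fs n x)%:E))) ->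
    (V f)%:E = ereal_sup (range (fun n => (V (fs n))%:E)).

Definition optimal V : Prop :=
  forall fs : nat -> E -> R,
    (forall n, Cb_plus (fs n)) ->
    (forall x, nonincreasing_seq (fun n => fs n x)) ->
    (forall x, fs n x @[n --> \oo] --> (0 : R)) ->
    V (fs n) @[n --> \oo] --> (0 : R).

(* On the empty space this is [sup set0 = 0]. *)
Definition sup_norm f : R := sup (range (fun x => `|f x|)).

Definition tight_form V : Prop :=
  forall e : R, 0 < e ->
    exists K : set E, compact K /\
      forall f, Cb_plus f -> (forall x, K x -> f x = 0) ->
        V f <= e * sup_norm f.

End Forms.

(* A set function on the Borel sets is encoded as a map on all sets of which
   only the values on Borel sets are ever considered. *)
Section Measures.
Context {R : realType} {E : topologicalType}.
Implicit Type nu : set E -> \bar R.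
Local Open Scope ereal_scope.

Definition maxitive_measure nu : Prop :=
  [/\ forall B, borel B -> 0 <= nu B,
      nu set0 = 0 &
      forall B1 B2, borel B1 -> borel B2 ->
        nu (B1 `|` B2) = maxe (nu B1) (nu B2)].

Definition finite_valued nu : Prop :=
  forall B, borel B -> nu B \is a fin_num.

Definition regular_measure nu : Prop :=
  forall B, borel B ->
    nu B = ereal_sup [set nu K | K in [set K | compact K /\ K `<=` B]] /\
    nu B = ereal_inf [set nu G | G in [set G | open G /\ B `<=` G]].

Definition tight_measure nu : Prop :=
  forall e : R, (0 < e)%R -> exists K : set E, compact K /\ nu (~` K) <= e%:E.

(* The convention [0 * +oo = 0] is the one built in [\bar R]. *)
Definition shilkret_integral nu (f : E -> \bar R) : \bar R :=
  ereal_sup [set t%:E * nu [set x | t%:E < f x] | t in [set t : R | (0 <= t)%R]].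

Definition max_cardinal_density nu (x : E) : \bar R :=
  ereal_inf [set nu G | G in [set G | open G /\ G x]].

Definition upper_compact (c : E -> \bar R) : Prop :=
  forall t : R, (0 < t)%R -> compact [set x | t%:E <= c x].

Definition represents (V : (E -> R) -> R) nu : Prop :=
  forall f, Cb_plus f -> (V f)%:E = shilkret_integral nu (EFin \o f).

End Measures.

(* Main.v *)
Require Import Defs.
From mathcomp Require Import all_boot all_order all_algebra.
From mathcomp Require Import all_classical all_reals all_analysis.
From mathcomp Require Import lra.

(** Put c(x) = inf {V f : f(x) > 1} and nu(B) = sup_(x in B) c(x). Sets {c < s}
    are open, which makes nu outer regular; points are compact, which makes it
    inner regular. If t c(x) <= s whenever t < f(x), then every x with f(x) > 0
    has, for each r > s, some g_x > f near x with V(g_x) <= r. Countably many of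
    these neighbourhoods cover {f > 0}, so f is the supremum of the
    min(f, g_(x_n)) and V f <= r; this is the hard half of the representation.
    Conversely tent functions around x show that any regular measure
    representing V gives {x} the mass c(x), and compactness extends this to all
    Borel sets.

    On a Polish space an optimal V is tight: if (s_i) is dense, the functions
    min(1, d(s_0, x), ..., d(s_(n-1), x)) decrease to 0, hence V of the n_k-th one
    is at most e/(k+1) for some n_k, and the set where for all k the n_k-th one
    is at most 1/(k+1) is compact. The implication from upper-compactness of c to
    optimality is Dini's theorem on {c >= t}. *)

Set Implicit Arguments.
Unset Strict Implicit.
Unset Printing Implicit Defensive.

Import Order.TTheory GRing.Theory Num.Theory.
Import numFieldNormedType.Exports.

Local Open Scope classical_set_scope.
Local Open Scope ring_scope.

(** * Separable and complete metric spaces *)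

Section CompatibleMetric.
Context {R : realType} {E : topologicalType} (d : E -> E -> R).
Context (d_compat : compatible_metric d).

Lemma dist_ge0 x y : 0 <= d x y.
Proof. by have [[]] := d_compat. Qed.

Lemma dist_refl x : d x x = 0.
Proof. by have [[_ /(_ x x)[_ ->]]] := d_compat. Qed.

Lemma dist_sym x y : d x y = d y x.
Proof. by have [[]] := d_compat. Qed.

Lemma dist_triangle y x z : d x z <= d x y + d y z.
Proof. by have [[]] := d_compat. Qed.

Lemma nbhs_dist (x : E) (e : R) : 0 < e -> nbhs x [set y | d x y < e].
Proof. by move=> e0; have [_ ->] := d_compat; exists e. Qed.

Lemma nbhs_distE (x : E) (A : set E) :
  nbhs x A -> exists2 e : R, 0 < e & forall y, d x y < e -> A y.
Proof. by have [_ ->] := d_compat => -[e e0 eA]; exists e. Qed.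

Lemma dist_continuous x : continuous (d x : E -> R).
Proof.
move=> y; apply/cvgrPdist_lt => e e0.
apply: filterS (nbhs_dist y e0) => z /= yz.
have := dist_triangle y x z; have := dist_triangle z x y.
rewrite (dist_sym z y) ltr_norml => ? ?; apply/andP; split; lra.
Qed.

Lemma metric_hausdorff : hausdorff_space E.
Proof.
move=> x y xy; have [[_ dE _ _] _] := d_compat; apply/dE/eqP.
rewrite eq_le dist_ge0 andbT leNgt; apply/negP => dxy.
have e0 : 0 < d x y / 2 by rewrite divr_gt0.
have [z [/= xz]] := xy _ _ (nbhs_dist x e0) (nbhs_dist y e0).
have := dist_triangle z x y; rewrite (dist_sym z y) => ? ?; lra.
Qed.

Lemma metric_compact_closed (K : set E) : compact K -> closed K.
Proof. by apply: compact_closed; exact: metric_hausdorff. Qed.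

Lemma open_dist x e : open [set y | d x y < e].
Proof.
rewrite (_ : [set _ | _] = d x @^-1` [set r | r < e])//.
by apply: open_comp => [y _|]; [exact: dist_continuous|exact: open_lt].
Qed.

Lemma dense_sequence (x0 : E) : separable E ->
  exists s : nat -> E, forall (x : E) (e : R), 0 < e -> exists i, d (s i) x < e.
Proof.
move=> [S /countable_injP[f finj] Sdense].
(* [xget] inverts the injection [f] of [S] into the integers; indices outside its image get the
   default [x0]. *)
exists (fun n => xget x0 [set x | S x /\ f x = n]) => x e e0.
have [|y [/= xy Sy]] := Sdense _ _ (open_dist x e).
  by exists x => /=; rewrite dist_refl.
exists (f y); case: xgetP => [z _ /= [Sz fzy]|/(_ y)]; last by case.
have -> : z = y by apply: finj => //; exact/mem_set.
by rewrite dist_sym.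
Qed.

(** For each ball with centre in a dense sequence and radius [1/(k+1)], pick, if possible, one point
    [y] of [A] such that [U y] contains the ball. A given [x] in [A] lies in such a ball inside
    [U x]; the point picked for that ball need not be [x], but its [U] contains the ball, hence
    [x]. *)
Lemma lindelof_neighbourhoods (A : set E) (U : E -> set E) :
  separable E -> A !=set0 -> (forall x, A x -> nbhs x (U x)) ->
  exists2 u : nat -> E, (forall n, A (u n)) &
    forall x, A x -> exists n, U (u n) x.
Proof.
move=> Esep [a Aa] AU; have [s sdense] := dense_sequence a Esep.
pose Q (p : nat * nat) := [set y | A y /\
  [set z | d (s p.1) z < p.2.+1%:R^-1] `<=` U y].
exists (fun n => if unpickle n is Some p then xget a (Q p) else a) => [n|x Ax].
  case: unpickle => // p; case: xgetP => [y _ /= [] //|_]; exact: Aa.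
have [e e0 eU] := nbhs_distE (AU _ Ax).
have [k] := @ltr_add_invr R 0 (e / 2) (divr_gt0 e0 (ltr0Sn _ _)).
rewrite add0r => ke; have k0 : 0 < k.+1%:R^-1 :> R by rewrite invr_gt0.
have [i ix] := sdense x _ k0; exists (pickle (i, k)); rewrite pickleK.
case: xgetP => [y _ /= [_]|/(_ x)[]]; first exact.
split=> // z /= iz; apply: eU; move: ix iz; have := dist_triangle (s i) x z.
rewrite (dist_sym x (s i)) ; move: ke; move: (k.+1%:R^-1) => q ? ? ? ?; lra.
Qed.

(** An ultrafilter containing [K] contains a ball of every radius. Balls of radius [1/(n+1)] in it
    meet pairwise, so their centres form a Cauchy sequence, whose limit is a limit of the
    ultrafilter. *)
Lemma complete_totally_bounded_compact (K : set E) :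
  complete_metric d -> closed K ->
  (forall e : R, 0 < e -> exists s : seq E,
     forall x, K x -> exists2 y, y \in s & d y x < e) ->
  compact K.
Proof.
move=> dcomplete Kclosed Ktb; rewrite compact_ultra => F FU FK.
have FP : ProperFilter F := ultra_proper.
have Fball (e : R) : 0 < e -> exists y, F [set x | d y x < e].
  move=> /Ktb[s Ks].
  have Fs : F [set x | exists2 y, y \in s & d y x < e] by apply: filterS FK.
  elim: s {Ks} Fs => [|a s IHs] Fs.
    by case: (filter_ex Fs) => x [].
  have [|Fa] := in_ultra_setVsetC [set x | d a x < e] FU; first by exists a.
  apply: IHs; apply: filterS (filterI Fs Fa) => x [[y +]].
  by rewrite inE => /orP[/eqP-> //|ys yx _]; exists y.
have inv0 n : 0 < n.+1%:R^-1 :> R by rewrite invr_gt0.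
have [c Fc] := choice (fun n => Fball _ (inv0 n)).
have inv_lt (e : R) : 0 < e ->
    exists N : nat, forall n, (N <= n)%N -> n.+1%:R^-1 < e.
  move=> e0; have [N] := ltr_add_invr e0; rewrite add0r => Ne.
  exists N => n Nn; apply: le_lt_trans Ne.
  by rewrite lef_pV2 ?posrE// ler_nat ltnS.
have [e e0|l cl] := dcomplete c.
  have [N Ne] := inv_lt _ (divr_gt0 e0 (ltr0Sn R 1)).
  exists N => m n /Ne me /Ne ne.
  have [x [/= mx nx]] := filter_ex (filterI (Fc m) (Fc n)).
  have := dist_triangle x (c m) (c n); rewrite (dist_sym x (c n)) => mn.
  move: me ne mx nx mn; move: (m.+1%:R^-1) (n.+1%:R^-1) => p q; lra.
have Fl : F --> l.
  move=> A /nbhs_distE[e e0 eA].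
  have e2 := divr_gt0 e0 (ltr0Sn R 1); have [N Ne] := inv_lt _ e2.
  have [M _ Mc] := cl _ (nbhs_dist l e2).
  have /= lc := Mc (maxn M N) (leq_maxl M N).
  have ne := Ne (maxn M N) (leq_maxr M N).
  apply: filterS (Fc (maxn M N)) => x /= cx; apply: eA.
  have := dist_triangle (c (maxn M N)) l x.
  by move: lc ne cx; move: ((maxn M N).+1%:R^-1) => p; lra.
exists l; split=> //; apply: Kclosed => A /Fl FA.
exact: filter_ex (filterI FK FA).
Qed.

End CompatibleMetric.

(** * Bounded continuous functions and tents *)

Section BoundedContinuous.
Context {R : realType} {E : topologicalType}.
Implicit Types (f g : E -> R) (r t : R).

Lemma Cb_plusP f : Cb_plus f <->
  [/\ continuous f, exists M, forall x, f x <= M & forall x, 0 <= f x].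
Proof.
split=> [[fc [M [_ fM]] f0]|[fc [M fM] f0]]; split=> //.
  exists (M + 1) => x; have M1 : M < M + 1 by rewrite ltrDl.
  exact: le_trans (ler_norm _) (fM _ M1 x I).
exists M; split; first exact: num_real.
by move=> N MN x _ /=; rewrite ger0_norm// (le_trans (fM x))// ltW.
Qed.

Lemma Cb_plus_cst t : 0 <= t -> Cb_plus (fun _ : E => t).
Proof. by move=> t0; apply/Cb_plusP; split=> // [x|]; [exact: cvg_cst|exists t]. Qed.

Lemma Cb_plusZ t f : 0 <= t -> Cb_plus f -> Cb_plus (fun x => t * f x).
Proof.
move=> t0 /Cb_plusP[fc [M fM] f0]; apply/Cb_plusP; split=> [x||x].
- by apply: cvgM; [exact: cvg_cst|exact: fc].
- by exists (t * M) => x; rewrite ler_wpM2l.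
- by rewrite mulr_ge0.
Qed.

Lemma Cb_plus_min f g : Cb_plus f -> continuous g -> (forall x, 0 <= g x) ->
  Cb_plus (fun x => Num.min (f x) (g x)).
Proof.
move=> /Cb_plusP[fc [M fM] f0] gc g0; apply/Cb_plusP.
split=> [x||x]; first exact: (continuous_min (fc x) (gc x)).
  by exists M => x; rewrite ge_min fM.
by rewrite le_min f0 g0.
Qed.

Lemma open_superlevel f t : Cb_plus f -> open [set x | t < f x].
Proof.
move=> [fc _ _]; rewrite (_ : [set _ | _] = f @^-1` [set r | t < r])//.
by apply: open_comp => [y _|]; [exact: fc|exact: open_gt].
Qed.

Lemma open_lt_Cb_plus f g : Cb_plus f -> Cb_plus g -> open [set x | f x < g x].
Proof.
move=> [fc _ _] [gc _ _].
rewrite (_ : [set _ | _] = (fun x => g x - f x) @^-1` [set r | 0 < r]).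
  apply: open_comp => [y _|]; last exact: open_gt.
  by apply: cvgB; [exact: gc|exact: fc].
by apply/seteqP; split=> x /=; rewrite subr_gt0.
Qed.

Lemma sup_norm_ge f x : Cb_plus f -> f x <= sup_norm f.
Proof.
move=> /Cb_plusP[_ [M fM] f0]; rewrite -[leLHS]ger0_norm//.
apply: ub_le_sup; last by exists x.
by exists M => _ [y _ <-]; rewrite ger0_norm.
Qed.

Lemma sup_norm_ge0 f : Cb_plus f -> 0 <= sup_norm f.
Proof.
move=> Cf; have [[x _]|/set0P/negP/negPn/eqP E0] := pselect ([set: E] !=set0).
  by apply: le_trans (sup_norm_ge x Cf); case: Cf.
by rewrite /sup_norm E0 image_set0 sup0.
Qed.

Lemma sup_norm_le f r : 0 <= r -> (forall x, `|f x| <= r) -> sup_norm f <= r.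
Proof.
move=> r0 fr; have [[x _]|] := pselect ([set: E] !=set0); last first.
  move=> /set0P/negP/negPn/eqP E0.
  by rewrite /sup_norm E0 image_set0 sup0.
by apply: ge_sup => [|_ [y _ <-]//]; exists `|f x|, x.
Qed.

Section Tent.
Context (d : E -> E -> R) (d_compat : compatible_metric d).

Definition tent (x : E) r t : E -> R := fun y => t * Num.max 0 (1 - d x y / r).

Lemma tent_center x r t : tent x r t x = t.
Proof.
by rewrite /tent dist_refl// mul0r subr0 (max_idPr _) ?ler01// mulr1.
Qed.

Lemma tent_le x r t y : 0 < r -> 0 <= t -> tent x r t y <= t.
Proof.
move=> r0 t0; rewrite /tent -[leRHS]mulr1 ler_wpM2l// ge_max ler01 gerBl.
by rewrite divr_ge0// ?(dist_ge0 d_compat)// ltW.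
Qed.

Lemma tent_out x r t y : 0 < r -> r <= d x y -> tent x r t y = 0.
Proof.
move=> r0 rxy; rewrite /tent (max_idPl _) ?mulr0//.
by rewrite subr_le0 ler_pdivlMr// mul1r.
Qed.

Lemma Cb_plus_tent x r t : 0 < r -> 0 <= t -> Cb_plus (tent x r t).
Proof.
move=> r0 t0; apply/Cb_plusP; split; last first.
- by move=> y; rewrite mulr_ge0// le_max lexx.
- by exists t => y; exact: tent_le.
move=> y; apply: cvgM; first exact: cvg_cst.
apply: (@continuous_max R E (fun=> 0) (fun z => 1 - d x z / r)).
  exact: cvg_cst.
apply: cvgB; first exact: cvg_cst.
by apply: cvgM; [exact: dist_continuous|exact: cvg_cst].
Qed.

End Tent.
End BoundedContinuous.

(** * Bounding a regular maxitive measure by its values on points *)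

Section MaxitiveMeasures.
Context {R : realType} {E : topologicalType} (d : E -> E -> R).
Context (d_compat : compatible_metric d).
Context (mu : set E -> \bar R).
Implicit Types A B G K : set E.

Lemma borel_open G : open G -> borel G.
Proof. by move=> Go; exact: sub_sigma_algebra. Qed.

Lemma borel_compact K : compact K -> borel K.
Proof.
move=> Kc; rewrite -[K]setCK -setTD; apply: sigma_algebraCD; apply: borel_open.
by rewrite openC; exact: (metric_compact_closed d_compat).
Qed.

Lemma borel_set1 (x : E) : borel [set x].
Proof. by apply: borel_compact; exact: compact_set1. Qed.

Context (mu_maxitive : maxitive_measure mu).

Lemma maxitive_measure_mono A B :
  borel A -> borel B -> A `<=` B -> (mu A <= mu B)%E.
Proof.
have [_ _ muU] := mu_maxitive.
by move=> bA bB /setUidPr AB; rewrite -AB muU// le_max lexx.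
Qed.

(* The open sets of measure less than [mu K] are stable under finite unions. If
   every point of [K] had one as a neighbourhood, so would [K] itself. *)
Lemma regular_measure_le B (z : \bar R) : regular_measure mu -> borel B ->
  (0 <= z)%E -> (forall x, B x -> (mu [set x] <= z)%E) -> (mu B <= z)%E.
Proof.
have [mu_ge0 mu0 muU] := mu_maxitive.
move=> mu_reg bB z0 Bz; have [-> _] := mu_reg _ bB.
apply: ge_ereal_sup => _ [K [Kc KB] <-]; rewrite leNgt; apply/negP => zK.
pose D := [set G | open G /\ (mu G < mu K)%E].
(* Along [F], eventually means for all sets containing some [G] in [D]. Compactness of [K] in its
   near-covering form then turns the local statements [H y] into [K] being contained in one [G] of
   [D]. *)
pose F := filter_from D (fun G => [set H | G `<=` H]).
have FF : Filter F.
  apply: filter_from_filter.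
    by exists set0; split; [exact: open0|rewrite mu0 (le_lt_trans z0)].
  move=> G H [Go GK] [Ho HK]; exists (G `|` H).
    split; first exact: openU.
    by rewrite muU ?gt_max ?GK//; exact: borel_open.
  by move=> L GHL; split=> x ?; apply: GHL; [left|right].
have /compact_near_coveringP/(_ _ F (fun H x => H x) FF) := Kc.
case=> [x Kx|G [Go GK] /(_ G (fun=> id)) KG].
  have [_ muE] := mu_reg _ (borel_set1 x).
  have /ereal_inf_lt[_ [G [Go xG] <-] GK] :
      (ereal_inf [set mu G | G in [set G | open G /\ [set x] `<=` G]] < mu K)%E.
    by rewrite -muE; apply: le_lt_trans zK; apply: Bz; exact: KB.
  exists (G, [set H | G `<=` H]); last by move=> [y H] /= [Gy GH]; exact: GH.
  split; first by apply: open_nbhs_nbhs; split=> //; exact: xG.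
  by exists G.
have := maxitive_measure_mono (borel_compact Kc) (borel_open Go) KG.
by rewrite leNgt GK.
Qed.

End MaxitiveMeasures.

(** * Linear forms and their densities *)

Section LinearForm.
Context {R : realType} {E : topologicalType} (d : E -> E -> R).
Context (d_compat : compatible_metric d).
Context (V : (E -> R) -> R) (V_linear : linear_form V).
Implicit Types (f g : E -> R) (B : set E).

Lemma form_ge0 f : Cb_plus f -> 0 <= V f.
Proof. by have [+ _ _] := V_linear; apply. Qed.

Lemma formZ t f : 0 <= t -> Cb_plus f -> V (fun x => t * f x) = t * V f.
Proof. by have [_ _ +] := V_linear; apply. Qed.

Lemma form_mono f g :
  Cb_plus f -> Cb_plus g -> (forall x, f x <= g x) -> V f <= V g.
Proof.
move=> Cf Cg fg; have [_ /(_ f g Cf Cg) + _] := V_linear.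
have -> : (fun x => Num.max (f x) (g x)) = g by apply/funext => x; exact/max_idPr.
by move=> ->; rewrite le_max lexx.
Qed.

Lemma form0 : V (fun=> 0) = 0.
Proof.
have C0 : Cb_plus (fun _ : E => 0 : R) by exact: Cb_plus_cst.
rewrite -[RHS](mul0r (V (fun=> 0))) -formZ//.
by congr V; apply/funext => x; rewrite mul0r.
Qed.

Definition density (x : E) : R :=
  inf [set V f | f in [set f | Cb_plus f /\ 1 < f x]].

Lemma has_inf_density x :
  has_inf [set V f | f in [set f | Cb_plus f /\ 1 < f x]].
Proof.
split; last by exists 0 => _ [f [Cf _] <-]; exact: form_ge0.
exists (V (fun=> 2)), (fun=> 2) => //; split; last by rewrite ltr1n.
exact: Cb_plus_cst.
Qed.

Lemma density_ge0 x : 0 <= density x.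
Proof.
apply: lb_le_inf; first by have [] := has_inf_density x.
by move=> _ [f [Cf _] <-]; exact: form_ge0.
Qed.

Lemma density_lt x s : density x < s ->
  exists f, [/\ Cb_plus f, 1 < f x & V f < s].
Proof.
move=> /inf_lt[|_ [f [Cf f1] <-] fs]; first by have [] := has_inf_density x.
by exists f.
Qed.

Lemma density_le f x : Cb_plus f -> 1 < f x -> density x <= V f.
Proof.
by move=> Cf f1; apply: ge_inf; [have [] := has_inf_density x|exists f].
Qed.

Lemma density_usc x s : density x < s ->
  exists G, [/\ open G, G x & forall y, G y -> density y < s].
Proof.
move=> /density_lt[f [Cf f1 fs]]; exists [set y | 1 < f y]; split=> //.
  exact: open_superlevel.
by move=> y fy; apply: le_lt_trans fs; exact: density_le.
Qed.

(** The function [f / t] exceeds 1 at [x], so it competes in the infimum defining [density x]. *)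
Lemma form_ge_density f x t :
  Cb_plus f -> 0 < t -> t < f x -> t * density x <= V f.
Proof.
move=> Cf t0 tf; rewrite -ler_pdivlMl// -formZ//; last by rewrite invr_ge0 ltW.
apply: density_le; first by apply: Cb_plusZ => //; rewrite invr_ge0 ltW.
by rewrite ltr_pdivlMl// mulr1.
Qed.

(** * The regular maxitive measure generated by the density *)

Definition density_measure B : \bar R :=
  ereal_sup (0%E |` [set (density x)%:E | x in B]).
Local Notation nu := density_measure.

(** The adjoined 0 gives the empty set measure 0 instead of [-oo]; hence the condition [0 <= z]. *)
Lemma density_measure_leP B (z : \bar R) :
  (nu B <= z)%E <-> (0 <= z)%E /\ forall x, B x -> ((density x)%:E <= z)%E.
Proof.
split=> [nuz|[z0 Bz]].
  by split=> [|x Bx]; apply: le_trans nuz; apply: ereal_sup_ubound;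
    [left|right; exists x].
by apply: ge_ereal_sup => _ [->//|[x Bx <-]]; exact: Bz.
Qed.

Lemma density_measure_ge0 B : (0 <= nu B)%E.
Proof. by have /density_measure_leP[] := lexx (nu B). Qed.

Lemma density_measure_ge B x : B x -> ((density x)%:E <= nu B)%E.
Proof. by move: x; have /density_measure_leP[] := lexx (nu B). Qed.

Lemma density_measure_mono A B : A `<=` B -> (nu A <= nu B)%E.
Proof.
move=> AB; apply/density_measure_leP; split=> [|x /AB].
  exact: density_measure_ge0.
exact: density_measure_ge.
Qed.

Lemma density_measure0 : nu set0 = 0%E.
Proof.
apply/eqP; rewrite eq_le density_measure_ge0 andbT.
by apply/density_measure_leP.
Qed.

Lemma density_measure_maxitive : maxitive_measure nu.
Proof.
split=> [B _||A B _ _]; first exact: density_measure_ge0.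
  exact: density_measure0.
apply/eqP; rewrite eq_le ge_max !density_measure_mono ?andbT; last 2 first.
- by move=> x; right.
- by move=> x; left.
apply/density_measure_leP; split=> [|x [Ax|Bx]]; rewrite le_max.
- by rewrite density_measure_ge0.
- by rewrite density_measure_ge.
- by rewrite orbC density_measure_ge.
Qed.

Lemma density_measure_fin B : nu B \is a fin_num.
Proof.
rewrite ge0_fin_numE ?density_measure_ge0//.
apply: (@le_lt_trans _ _ (V (fun=> 2))%:E); last exact: ltry.
have C2 : Cb_plus (fun _ : E => 2 : R) by exact: Cb_plus_cst.
apply/density_measure_leP; split=> [|x _]; rewrite lee_fin.
  exact: form_ge0.
by apply: density_le => //; rewrite ltr1n.
Qed.

Lemma density_measure_outer B s : (nu B < s%:E)%E ->
  exists G, [/\ open G, B `<=` G & (nu G <= s%:E)%E].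
Proof.
move=> Bs; exists (\bigcup_(G in [set G | open G /\
  forall y, G y -> density y < s]) G).
have [s0 _] : (0 <= s%:E)%E /\ forall x, B x -> ((density x)%:E <= s%:E)%E.
  by apply/density_measure_leP; exact: ltW.
split; first by apply: bigcup_open => G [].
- move=> x Bx; have [|G [Go Gx Gs]] := @density_usc x s; last by exists G.
  by rewrite -lte_fin; apply: le_lt_trans Bs; exact: density_measure_ge.
- apply/density_measure_leP; split=> // x [G [_ Gs] Gx].
  by rewrite lee_fin ltW// Gs.
Qed.

Lemma density_measure_regular : regular_measure nu.
Proof.
move=> B _; split; apply/eqP; rewrite eq_le; apply/andP; split.
- apply/density_measure_leP; split=> [|x Bx].
    rewrite -density_measure0; apply: ereal_sup_ubound.
    by exists set0 => //; split=> //; exact: compact0.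
  apply: (@le_trans _ _ (nu [set x])); first exact: density_measure_ge.
  apply: ereal_sup_ubound; exists [set x] => //; split; first exact: compact_set1.
  by move=> _ ->.
- apply: ge_ereal_sup => _ [K [_ KB] <-]; exact: density_measure_mono.
- apply: le_ereal_inf_tmp => _ [G [_ BG] <-]; exact: density_measure_mono.
- apply/lee_addgt0Pr => e e0.
  have [|G [Go BG Ge]] := @density_measure_outer B (fine (nu B) + e).
    by rewrite EFinD fineK ?density_measure_fin// lteDl ?density_measure_fin// lte_fin.
  apply: ge_ereal_inf; exists (nu G); first by exists G.
  by rewrite EFinD fineK ?density_measure_fin in Ge.
Qed.

(** By upper semicontinuity the density stays below [density x + e] on some open neighbourhood of
    [x]. *)
Lemma max_cardinal_densityE x : max_cardinal_density nu x = (density x)%:E.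
Proof.
apply/eqP; rewrite eq_le; apply/andP; split; last first.
  by apply: le_ereal_inf_tmp => _ [G [_ Gx] <-]; exact: density_measure_ge.
apply/lee_addgt0Pr => e e0.
have [|G [Go Gx Ge]] := @density_usc x (density x + e); first by rewrite ltrDl.
apply: ge_ereal_inf; exists (nu G); first by exists G.
apply/density_measure_leP; split=> [|y Gy]; rewrite -EFinD lee_fin.
  by rewrite addr_ge0 ?density_ge0// ltW.
by rewrite ltW// Ge.
Qed.

(** * From tightness of the form to compact superlevel sets *)

Lemma density_le_tight K e : compact K -> 0 < e ->
  (forall f, Cb_plus f -> (forall x, K x -> f x = 0) ->
    V f <= e / 2 * sup_norm f) ->
  forall x, ~ K x -> density x <= e.
Proof.
move=> Kc e0 Ke x Kx.
have Ko : open (~` K).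
  by rewrite openC; apply: (metric_compact_closed d_compat).
have [r r0 rK] := nbhs_distE d_compat (open_nbhs_nbhs (conj Ko Kx)).
(* The height 2 exceeds 1 at [x], as [density] demands, and cancels the 2 in [e / 2]. *)
have Cb : Cb_plus (tent d x r 2) by exact: Cb_plus_tent.
apply: (@le_trans _ _ (V (tent d x r 2))).
  by apply: density_le => //; rewrite tent_center ?ltr1n.
apply: (le_trans (Ke _ Cb _)) => [y Ky|].
  apply: tent_out => //; rewrite leNgt; apply/negP => /rK; exact.
rewrite -[leRHS](divfK (_ : 2 != 0 :> R))// ler_wpM2l//.
  by rewrite divr_ge0// ltW.
apply: sup_norm_le => // y; rewrite ger0_norm; first exact: tent_le.
by case: Cb.
Qed.

Lemma tight_form_measure : tight_form V -> tight_measure nu.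
Proof.
move=> Vt e e0; have [|K [Kc Ke]] := Vt (e / 2); first by rewrite divr_gt0.
exists K; split=> //; apply/density_measure_leP; split=> [|x Kx].
  by rewrite lee_fin ltW.
rewrite lee_fin; exact: density_le_tight Kx.
Qed.

(** The set [{c >= t}] is closed by upper semicontinuity, and lies in any compact set whose
    complement has measure at most [t / 2]. *)
Lemma tight_measure_upper_compact :
  tight_measure nu -> upper_compact (max_cardinal_density nu).
Proof.
move=> nut t t0; have [|K [Kc Kt]] := nut (t / 2); first by rewrite divr_gt0.
apply: subclosed_compact Kc _; last first.
  move=> x /=; rewrite max_cardinal_densityE lee_fin => tx.
  apply: contrapT => Kx.
  have := le_trans (density_measure_ge (B := ~` K) Kx) Kt.
  by rewrite lee_fin; lra.
rewrite -openC openE => x /=; rewrite max_cardinal_densityE lee_fin.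
move=> /negP; rewrite -ltNge => /density_usc[G [Go Gx Gt]].
rewrite /interior nbhsE; exists G => // y /Gt /=.
by rewrite max_cardinal_densityE lee_fin ltNge => /negP.
Qed.

(** * Representation through countable suprema *)

Context (E_separable : separable E) (V_sup : preserves_countable_sup V).

Lemma form_sup_le (fs : nat -> E -> R) f s :
  (forall n, Cb_plus (fs n)) -> Cb_plus f -> (forall n x, fs n x <= f x) ->
  (forall x, exists n, f x <= fs n x) -> (forall n, V (fs n) <= s) -> V f <= s.
Proof.
move=> Cfs Cf fsf ffs fss; rewrite -lee_fin (V_sup Cfs Cf) => [|x].
  by apply: ge_ereal_sup => _ [n _ <-]; rewrite lee_fin.
apply/eqP; rewrite eq_le; apply/andP; split.
  have [n fn] := ffs x; apply: le_ereal_sup_tmp.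
  by exists (fs n x)%:E; [exists n|rewrite lee_fin].
by apply: ge_ereal_sup => _ [n _ <-]; rewrite lee_fin.
Qed.

(** The hypothesis says that [s] bounds the Shilkret integral of [f], written pointwise. This is the
    only way in which upper bounds on [V] are derived from the density. *)
Lemma form_le_density f s : Cb_plus f -> 0 <= s ->
  (forall x t, 0 < t -> t < f x -> t * density x <= s) -> V f <= s.
Proof.
move=> Cf s0 fs; have f0 x : 0 <= f x by case: Cf.
have [A0|] := pselect ([set x | 0 < f x] !=set0); last first.
  move=> A0; suff -> : f = fun=> 0 by rewrite form0.
  apply/funext => x; apply/eqP; rewrite eq_le f0 andbT leNgt.
  by apply/negP => fx; apply: A0; exists x.
apply/ler_addgt0Pr => e e0; set r := s + e.
have r0 : 0 < r by rewrite ltr_wpDl.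
have cov x : exists g, 0 < f x -> [/\ Cb_plus g, V g <= r & f x < g x].
  have [fx|fx] := ltP 0 (f x); last by exists (fun=> 0).
  have [|g [Cg g1 gr]] := @density_lt x (r / f x).
    (* This [t] is just below [f x], yet [s / t = (r / f x) * s / (s + e / 2)] is still less than
       [r / f x]. The [e / 2] keeps [t] positive when [s = 0]. *)
    pose t := f x * ((s + e / 2) / r).
    have se : 0 < s + e / 2 by rewrite ltr_wpDl ?divr_gt0.
    have t0 : 0 < t by rewrite !mulr_gt0// invr_gt0.
    have tf : t < f x by rewrite gtr_pMr// ltr_pdivrMr// mul1r /r; lra.
    have := fs x t t0 tf; rewrite -ler_pdivlMl// => /le_lt_trans; apply.
    rewrite ltr_pdivrMl// /t mulrC mulrA divfK ?gt_eqF// mulrC divfK ?gt_eqF//.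
    by move: e0; lra.
  exists (fun y => f x * g y) => _; split; first exact: Cb_plusZ.
    by rewrite formZ// mulrC -ler_pdivlMr// ltW.
  by rewrite ltr_pMr.
have [g gP] := choice cov.
have [|u Au uA] := lindelof_neighbourhoods d_compat
    (U := fun x => [set y | f y < g x y]) E_separable A0.
  move=> x /gP[Cg _ fg].
  by apply: open_nbhs_nbhs; split=> //; exact: open_lt_Cb_plus.
(* Each [h n] lies below [f] and agrees with it where [f < g (u n)]. These sets cover [{f > 0}], so
   the supremum is attained at every point. *)
pose h n y := Num.min (f y) (g (u n) y).
have Ch n : Cb_plus (h n).
  by have [[gc _ g0] _ _] := gP _ (Au n); exact: Cb_plus_min.
apply: (form_sup_le Ch Cf) => [n x|x|n].
- by rewrite ge_min lexx.
- have [/uA[n /= fg]|fx] := ltP 0 (f x).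
    by exists n; rewrite le_min lexx ltW.
  exists 0%N; apply: (le_trans fx); by have [] := Ch 0%N.
- have [Cg gr _] := gP _ (Au n); apply: le_trans gr.
  apply: form_mono => [||x]; rewrite ?ge_min ?lexx ?orbT//.
Qed.
Lemma density_measure_represents : represents V nu.
Proof.
move=> f Cf; apply/eqP; rewrite eq_le; apply/andP; split; last first.
  apply: ge_ereal_sup => _ [t /= + <-]; rewrite le0r => /orP[/eqP->|t0].
    by rewrite mul0e lee_fin form_ge0.
  rewrite -lee_pdivlMl// -EFinM; apply/density_measure_leP; split=> [|x].
    by rewrite lee_fin mulr_ge0 ?form_ge0// invr_ge0 ltW.
  by rewrite /= lte_fin lee_fin ler_pdivlMl// => tf; exact: form_ge_density.
have I_ge (t : R) : 0 <= t ->
    (t%:E * nu [set x | (t%:E < (f x)%:E)%E] <= shilkret_integral nu (EFin \o f))%E.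
  by move=> t0; apply: ereal_sup_ubound; exists t.
(* The term at [t = 0] is 0, which rules out [-oo] and gives [0 <= s] for a real value. *)
move: I_ge; case: (shilkret_integral _ _) => [s||] I_ge.
- have s0 : 0 <= s by have := I_ge 0 (lexx 0); rewrite mul0e lee_fin.
  rewrite lee_fin; apply: form_le_density => // x t t0 tf.
  rewrite -lee_fin EFinM; apply: le_trans (I_ge t (ltW t0)).
  apply: lee_wpmul2l; first by rewrite lee_fin ltW.
  by apply: density_measure_ge; rewrite /= lte_fin.
- by rewrite leey.
- by have := I_ge 0 (lexx 0); rewrite mul0e leeNy_eq.
Qed.

(** * Compact superlevel sets, optimality and tightness of the form *)

Lemma upper_compact_optimal :
  upper_compact (max_cardinal_density nu) -> optimal V.
Proof.
move=> cc fs Cfs fs_mono fs_cvg; apply/cvgrPdist_lt => e e0.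
have [_ [M fM] _] := (Cb_plusP (fs 0%N)).1 (Cfs 0%N).
have C2 : Cb_plus (fun _ : E => 2 : R) by exact: Cb_plus_cst.
have M0 : 0 < `|M| + 1 by rewrite ltr_wpDl.
have N0 : 0 < V (fun=> 2) + 1 by rewrite ltr_wpDl// form_ge0.
have e2 : 0 < e / 2 by rewrite divr_gt0.
(* The threshold is such that off [K] the density is small while [t < fs n x <= M]; on [K] the
   density is at most [V 2] and [t] becomes uniformly small. Either way [t * density x <= e / 2].
   The added 1s keep the denominators positive. *)
have /cc/compact_near_coveringP Kc : 0 < e / 2 / (`|M| + 1) by rewrite divr_gt0.
set K := [set x | _] in Kc.
have K_unif : \forall n \near \oo,
    K `<=` [set x | fs n x < e / 2 / (V (fun=> 2) + 1)].
  apply: Kc => x _.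
  have /cvgrPdist_lt/(_ _ (divr_gt0 e2 N0))[N _ Ne] := fs_cvg x.
  exists ([set y | fs N y < e / 2 / (V (fun=> 2) + 1)], [set n | (N <= n)%N]).
    split; last by exists N.
    apply: open_nbhs_nbhs; split.
      by apply: open_lt_Cb_plus => //; apply: Cb_plus_cst; rewrite divr_ge0// ltW.
    have := Ne N (leqnn N); rewrite /= sub0r normrN; exact: le_lt_trans (ler_norm _).
  (* Monotonicity passes the bound at index [N] on to all later indices. *)
  by move=> [y n] /= [yN Nn]; apply: le_lt_trans yN; exact: fs_mono.
apply: filterS K_unif => n Kn; rewrite sub0r normrN ger0_norm ?form_ge0//.
apply: (@le_lt_trans _ _ (e / 2)); last by move: e0; lra.
apply: form_le_density => // [|x t t0 tf]; first exact: ltW.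
have [Kx|Kx] := pselect (K x).
  rewrite -[leRHS](divfK (lt0r_neq0 N0)) ler_pM ?density_ge0//.
  - exact: ltW.
  - by apply: ltW; apply: lt_trans (Kn _ Kx).
  - apply: (@le_trans _ _ (V (fun=> 2))); last by rewrite lerDl.
    by apply: density_le => //; rewrite ltr1n.
rewrite -[leRHS](divfK (lt0r_neq0 M0)) mulrC ler_pM ?density_ge0//.
- exact: ltW.
- apply: ltW; rewrite ltNge; apply/negP => cx; apply: Kx.
  by rewrite /K /= max_cardinal_densityE lee_fin.
- apply: (le_trans (ltW tf)); apply: (le_trans (fs_mono x _ _ (leq0n n))).
  by rewrite (le_trans (fM x))// (le_trans (ler_norm M))// lerDl.
Qed.

Lemma optimal_tight_form : complete_metric d -> optimal V -> tight_form V.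
Proof.
move=> dcomplete Vopt e e0.
(* The empty space is set apart because a dense sequence needs a point. *)
have [[x0 _]|E0] := pselect ([set: E] !=set0); last first.
  exists set0; split; first exact: compact0.
  move=> f Cf _; apply: (@le_trans _ _ 0).
    rewrite -form0 (_ : f = fun=> 0)//.
    by apply/funext => x; exfalso; apply: E0; exists x.
  by rewrite mulr_ge0 ?sup_norm_ge0// ltW.
have [s sdense] := dense_sequence d_compat x0 E_separable.
pose F := fix F n : E -> R :=
  if n is m.+1 then fun x => Num.min (F m x) (d (s m) x) else fun=> 1.
have CF n : Cb_plus (F n).
  elim: n => [|n IHn]; first exact: Cb_plus_cst.
  apply: Cb_plus_min => // [|x]; first exact: dist_continuous.
  exact: (dist_ge0 d_compat).
have F_mono x : nonincreasing_seq (F^~ x).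
  by apply/nonincreasing_seqP => n /=; rewrite ge_min lexx.
have F_cvg x : F n x @[n --> \oo] --> (0 : R).
  apply/cvgrPdist_lt => r r0; have [i ir] := sdense x _ r0.
  exists i.+1 => // n /= ni; rewrite sub0r normrN ger0_norm; last by case: (CF n).
  apply: le_lt_trans ir; apply: le_trans (F_mono x _ _ ni) _.
  by rewrite /= ge_min lexx orbT.
have F_lt n x r : r <= 1 -> F n x < r -> exists2 i, (i < n)%N & d (s i) x < r.
  move=> r1; elim: n => [|n IHn] /=; first by rewrite ltNge r1.
  rewrite gt_min => /orP[/IHn[i ni ir]|nr]; last by exists n.
  by exists i => //; exact: ltnW.
have /choice[N VN] k : exists n, V (F n) <= e / k.+1%:R.
  have /cvgrPdist_lt/(_ (e / k.+1%:R)) := Vopt _ CF F_mono F_cvg.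
  move=> /(_ (divr_gt0 e0 (ltr0Sn R k)))[n _ /(_ n (leqnn n))/=].
  by rewrite sub0r normrN => /ltW; exists n; apply: le_trans (ler_norm _) _.
pose h k x := k.+1%:R * F (N k) x.
have Ch k : Cb_plus (h k) by exact: Cb_plusZ.
have Vh k : V (h k) <= e by rewrite formZ// mulrC -ler_pdivlMr.
(* Off [K] some [h k] exceeds 1, although [V (h k) <= e] for all [k]. *)
pose K := \bigcap_k [set x | h k x <= 1].
have K_closed : closed K.
  apply: closed_bigI => k _; rewrite -openC (_ : ~` _ = [set x | 1 < h k x]).
    exact: open_superlevel.
  by apply/seteqP; split=> x /=; rewrite ltNge => /negP.
exists K; split.
  apply: (complete_totally_bounded_compact d_compat) => // r r0.
  (* The cap at 1 rules out the initial constant 1 in [F], so a small value of [F (N k) x] must come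
     from some [d (s i) x] with [i < N k]. *)
  have r1 : 0 < Num.min r 1 by rewrite lt_min r0 ltr01.
  have [k] := ltr_add_invr r1; rewrite add0r => kr.
  exists (map s (iota 0 (N k))) => x Kx.
  have [||i iN ix] := F_lt (N k) x (Num.min r 1).
  - by rewrite ge_min lexx orbT.
  - apply: le_lt_trans kr; have := Kx k I.
    by rewrite /= /h -ler_pdivlMl// mulr1.
  exists (s i); first by rewrite map_f// mem_iota.
  by apply: lt_le_trans ix _; rewrite ge_min lexx.
move=> f Cf f0; have Sf := sup_norm_ge0 Cf.
have CSh k : Cb_plus (fun x => sup_norm f * h k x) by exact: Cb_plusZ.
(* The supremum over [k] of these minima is [f]: on [K] all of them vanish with [f], and off [K] a
   factor [h k x > 1] lifts [sup_norm f * h k x] above [f x]. *)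
have Cg k : Cb_plus (fun x => Num.min (f x) (sup_norm f * h k x)).
  by apply: Cb_plus_min => //; case: (CSh k).
apply: (form_sup_le Cg Cf) => [n x|x|n].
- by rewrite ge_min lexx.
- have [Kx|Kx] := pselect (K x).
    by exists 0%N; rewrite f0// le_min lexx; case: (CSh 0%N) => _ _ ->.
  have [k /negP] : exists k, ~ h k x <= 1.
    by apply: contrapT => /forallNP hK; apply: Kx => k _; apply: contrapT (hK k).
  rewrite -ltNge => hk; exists k; rewrite le_min lexx.
  by rewrite (le_trans (sup_norm_ge x Cf))// ler_peMr// ltW.
- apply: (@le_trans _ _ (V (fun x => sup_norm f * h n x))).
    apply: form_mono => [||x]; rewrite ?ge_min ?lexx ?orbT//.
  by rewrite formZ// mulrC ler_wpM2r.
Qed.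

(** * Uniqueness of the representing measure *)

Lemma regular_measure_set1 mu x : maxitive_measure mu -> regular_measure mu ->
  represents V mu -> mu [set x] = (density x)%:E.
Proof.
move=> mu_max mu_reg Vmu; have [mu_ge0 mu0 _] := mu_max.
have bx := borel_set1 d_compat x.
apply/eqP; rewrite eq_le; apply/andP; split.
  apply/lee_addgt0Pr => e e0.
  have [|f [Cf f1 fe]] := @density_lt x (density x + e); first by rewrite ltrDl.
  rewrite -EFinD; apply: (@le_trans _ _ (V f)%:E); last by rewrite lee_fin ltW.
  (* The term [t = 1] of the integral of [f] is the measure of [{f > 1}], which contains [x]. *)
  rewrite (Vmu _ Cf); apply: (@le_trans _ _ (mu [set y | 1 < f y])).
    apply: maxitive_measure_mono => // [|_ ->//].
    by apply: borel_open; exact: open_superlevel.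
  apply: ereal_sup_ubound; exists 1 => //=.
  by rewrite mul1e; congr mu; apply/seteqP; split=> y /=; rewrite lte_fin.
have [_ ->] := mu_reg _ bx; apply: le_ereal_inf_tmp => _ [G [Go /(_ x (erefl x)) Gx] <-].
have := mu_ge0 _ (borel_open Go); case muG : (mu G) => [m||]//; rewrite ?leey// !lee_fin.
(* A tent at [x] supported in [G] needs height [t > 1] to bound [density x], at the cost of a factor
   [t]. This choice gives [t * m <= m + e], also for [m = 0]. *)
move=> m0; apply/ler_addgt0Pr => e e0; pose t := 1 + e / (m + 1).
have m1 : 0 < m + 1 by rewrite ltr_wpDl.
have t1 : 1 < t by rewrite ltrDl divr_gt0.
have t0 : 0 < t by rewrite (lt_trans _ t1).
have [r r0 rG] := nbhs_distE d_compat (open_nbhs_nbhs (conj Go Gx)).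
have Ct : Cb_plus (tent d x r t) by apply: Cb_plus_tent => //; exact: ltW.
apply: (@le_trans _ _ (V (tent d x r t))).
  by apply: density_le => //; rewrite tent_center.
apply: (@le_trans _ _ (t * m)); last first.
  rewrite mulrDl mul1r lerD2l mulrAC ler_pdivrMr// ler_wpM2l// ?lerDl//.
  exact: ltW.
rewrite -lee_fin (Vmu _ Ct); apply: ge_ereal_sup => _ [s /= s0 <-].
(* Levels [s] at or above the height of the tent have an empty superlevel set; the others have one
   inside [G]. *)
have [st|ts] := ltP s t; last first.
  rewrite (_ : [set _ | _] = set0) ?mu0 ?mule0 ?lee_fin ?mulr_ge0// ?ltW//.
  rewrite -subset0 => y /=; rewrite lte_fin ltNge => /negP; apply.
  by apply: le_trans ts; apply: tent_le => //; exact: ltW.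
apply: (@le_trans _ _ (s%:E * mu G)%E); last first.
  by rewrite muG -EFinM lee_fin ler_wpM2r// ltW.
apply: lee_wpmul2l; first by rewrite lee_fin.
apply: maxitive_measure_mono => //; last 2 first.
- exact: borel_open.
- move=> y /=; rewrite lte_fin => sy; apply: rG; rewrite ltNge; apply/negP => ry.
  by move: sy; rewrite tent_out// ltNge s0.
apply: borel_open; rewrite (_ : [set _ | _] = [set y | s < tent d x r t y]).
  exact: open_superlevel.
by apply/seteqP; split=> y /=; rewrite lte_fin.
Qed.

End LinearForm.

Theorem theorem9p5 (R : realType) (E : topologicalType) (V : (E -> R) -> R)
    (E_metrizable : metrizable R E) (E_separable : separable E)
    (V_linear : linear_form V) (V_sup : preserves_countable_sup V) :
  exists nu : set E -> \bar R,
    [/\ maxitive_measure nu, finite_valued nu, regular_measure nu &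
        represents V nu] /\
    (forall nu' : set E -> \bar R,
        maxitive_measure nu' -> regular_measure nu' -> represents V nu' ->
        forall B : set E, borel B -> nu' B = nu B) /\
    (polish R E ->
      [<-> optimal V;
           tight_form V;
           tight_measure nu;
           upper_compact (max_cardinal_density nu)]).
Proof.
have [d d_compat] := E_metrizable.
exists (density_measure V); split; [split|split].
- exact: density_measure_maxitive.
- by move=> B _; exact: density_measure_fin.
- exact: density_measure_regular.
- exact: (density_measure_represents d_compat).
- move=> mu mu_max mu_reg Vmu B bB.
  have mu1 x : mu [set x] = (density V x)%:E.
    exact: (regular_measure_set1 d_compat).
  apply/eqP; rewrite eq_le; apply/andP; split.
    apply: (regular_measure_le d_compat) => // [|x Bx].
      exact: density_measure_ge0.
    by rewrite mu1; exact: density_measure_ge.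
  apply/density_measure_leP; split=> [|x Bx]; first by have [->] := mu_max.
  rewrite -mu1; apply: maxitive_measure_mono => //; last by move=> _ ->.
  exact: (borel_set1 d_compat).
(* The density measure is defined without a metric, so the complete metric [D] can replace [d]. *)
- move=> [_ [D [D_compat D_complete]]]; tfae.
  + exact: (optimal_tight_form D_compat).
  + exact: (tight_form_measure D_compat).
  + exact: tight_measure_upper_compact.
  + exact: (upper_compact_optimal D_compat).
Qed.
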